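(* Let $f\in C^2(\mathbb{R}^n)$ be a strictly convex function (in the sense that its Hessian is positive definite at every point) which has a unique minimum point $\mathbf{x}^\star$, and let $t^\star=f(\mathbf{x}^\star)$. Let $\mathbf{x}_0\in\mathbb{R}^n$ and let $\mathbf{x}_k$, $k\in\mathbb{N}$, be given by the partial minimization algorithm described in the context, with respect to a fixed division of the $n$ variables into $d\ge 2$ groups. Set $t_k=f(\mathbf{x}_k)$ for $k\in\mathbb{Z}_+=\{0,1,2,\ldots\}$. Let $[\alpha(t_k),\beta(t_k)]$, $0<\alpha(t_k)\le\beta(t_k)$, be the minimal interval containing the eigenvalues of $H(f)(\mathbf{x})$ for all $\mathbf{x}\in V(t_k)$, and denote $\kappa(t_k)=\frac{\beta(t_k)}{\alpha(t_k)}$. Then: (1) If $\mathbf{x}_{k-1}\ne\mathbf{x}^\star$ for some $k\in\mathbb{N}$ then $t_{k-1}>t_k$. (2) The sequences $\{t_k\},\{\beta(t_k)\},\{-\alpha(t_k)\},\{\kappa(t_k)\}$, $k\in\mathbb{Z}_+$, are nonincreasing and converge to $t^\star,\beta(t^\star),-\alpha(t^\star),\kappa(t^\star)$ respectively. (3) For each $k\in\mathbb{N}$ the following inequalities hold: $$f(\mathbf{x}_k)-f(\mathbf{x}^\star)\le (f(\mathbf{x}_0)-f(\mathbf{x}^\star))\Big(1-\frac{1}{d\kappa(t_0)}\Big)\prod_{i=1}^{k-1}\Big(1-\frac{1}{(d-1)\kappa(t_i)}\Big)$$ $$\le \frac{\|\nabla f(\mathbf{x}_0)\|^2}{2\alpha(t_0)}\Big(1-\frac{1}{d\kappa(t_0)}\Big)\prod_{i=1}^{k-1}\Big(1-\frac{1}{(d-1)\kappa(t_i)}\Big)$$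 $$\le \frac{\|\nabla f(\mathbf{x}_0)\|^2}{2\alpha(t_0)}\Big(1-\frac{1}{d\kappa(t_0)}\Big)\Big(1-\frac{1}{(d-1)\kappa(t_0)}\Big)^{k-1},$$ and $$\|\mathbf{x}_k-\mathbf{x}^\star\|^2\le \frac{\|\nabla f(\mathbf{x}_0)\|^2}{\alpha(t_k)\alpha(t_0)}\Big(1-\frac{1}{d\kappa(t_0)}\Big)\prod_{i=1}^{k-1}\Big(1-\frac{1}{(d-1)\kappa(t_i)}\Big).$$
   Context: $\mathbb{N}=\{1,2,\ldots\}$, $[d]=\{1,\ldots,d\}$, $\|\cdot\|$ is the Euclidean norm, and empty products equal $1$. $H(f)(\mathbf{x})$ is the Hessian of $f$ at $\mathbf{x}$. For $t\ge t^\star$, $V(t)=\{\mathbf{y}\in\mathbb{R}^n : f(\mathbf{y})\le t\}$ is the sublevel set, which is compact and convex, with $V(t^\star)=\{\mathbf{x}^\star\}$; $\alpha(t)$ and $\beta(t)$ are respectively the minimum of the smallest eigenvalue and the maximum of the largest eigenvalue of $H(f)$ over $V(t)$, and $\kappa(t)=\beta(t)/\alpha(t)$ (including for $t=t^\star$). Division of variables: $d\in\{2,\ldots,n\}$ and $\mathbf{x}\in\mathbb{R}^n$ is divided as $\mathbf{x}^\top=(\mathbf{x}_1^\top,\ldots,\mathbf{x}_d^\top)$ with blocks $\mathbf{x}_i\in\mathbb{R}^{m_i}$, $m_i\ge 1$, $\sum_{i=1}^d m_i=n$. For $j\in[d]$, $\mathbf{x}^j\in\mathbb{R}^{n-m_j}$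 is obtained from $\mathbf{x}$ by deleting the block $\mathbf{x}_j$, and one writes $\mathbf{x}=(\mathbf{x}^j,\mathbf{x}_j)$. $\nabla_j f(\mathbf{x})\in\mathbb{R}^{m_j}$ is the vector of partial derivatives of $f$ with respect to the coordinates in $\mathbf{x}_j$. For given $\mathbf{x}^j$, $\mathbf{x}_j(\mathbf{x}^j)\in\mathbb{R}^{m_j}$ denotes the unique minimizer of $\mathbf{x}_j\mapsto f(\mathbf{x}^j,\mathbf{x}_j)$ over $\mathbb{R}^{m_j}$. Partial minimization algorithm: choose $\mathbf{x}_0\in\mathbb{R}^n$; for $k=0,1,2,\ldots$ choose any $j\in\arg\max\{\|\nabla_l f(\mathbf{x}_k)\| : l\in[d]\}$ and set $\mathbf{x}_{k+1}=(\mathbf{x}_k^j,\mathbf{x}_j(\mathbf{x}_k^j))$. (Here $\mathbf{x}_k$ with $k$ the iteration index is a vector of $\mathbb{R}^n$, $\mathbf{x}_k^j$ is $\mathbf{x}_k$ with its $j$-th block deleted, and $\mathbf{x}_j(\mathbf{x}_k^j)$ is the unique minimizer of $\mathbf{y}\mapsto f(\mathbf{x}_k^j,\mathbf{y})$ over $\mathbf{y}\in\mathbb{R}^{m_j}$, where $\mathbf{y}$ is placed in the $j$-th block.) *)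

(* Defs.v *)
From HB Require Import structures.
From mathcomp Require Import all_boot all_order all_algebra.
From mathcomp Require Import all_classical all_reals all_analysis.
Set Implicit Arguments.
Unset Strict Implicit.
Unset Printing Implicit Defensive.
Import Order.TTheory GRing.Theory Num.Theory.
Import numFieldNormedType.Exports.
Local Open Scope classical_set_scope.
Local Open Scope ring_scope.

(* The library norm `|v| on matrices is the sup norm, hence this definition. *)
Definition enorm (R : realType) (n : nat) (v : 'rV[R]_n) : R :=
  Num.sqrt (\sum_i v 0 i ^+ 2).

Definition partial (R : realType) (n : nat) (i : 'I_n) (f : 'rV[R]_n -> R)
    (x : 'rV[R]_n) : R :=
  'D_(delta_mx 0 i) f x.

Definition grad (R : realType) (n : nat) (f : 'rV[R]_n -> R) (x : 'rV[R]_n) :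
    'rV[R]_n :=
  \row_i partial i f x.

Definition hessian (R : realType) (n : nat) (f : 'rV[R]_n -> R)
    (x : 'rV[R]_n) : 'M[R]_n :=
  \matrix_(i, j) partial i (partial j f) x.

Definition C1 (R : realType) (n : nat) (f : 'rV[R]_n -> R) : Prop :=
  continuous f /\
  forall i : 'I_n, (forall x, derivable f x (delta_mx 0 i)) /\
                   continuous (partial i f).

Definition C2 (R : realType) (n : nat) (f : 'rV[R]_n -> R) : Prop :=
  C1 f /\ forall i : 'I_n, C1 (partial i f).

(* No symmetry is required here: it is automatic for the Hessian of a C^2
   function. *)
Definition pos_def (R : realType) (n : nat) (A : 'M[R]_n) : Prop :=
  forall v : 'rV[R]_n, v != 0 -> 0 < (v *m A *m v^T) 0 0.

Definition minimizer (R : realType) (T : Type) (g : T -> R) (y : T) : Prop :=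
  forall z, g y <= g z.

Definition sublevel (R : realType) (n : nat) (f : 'rV[R]_n -> R) (t : R) :
    set 'rV[R]_n :=
  [set y | f y <= t].

Definition hessian_eigenvalues (R : realType) (n : nat) (f : 'rV[R]_n -> R)
    (t : R) : set R :=
  [set a | exists2 x, sublevel f t x & eigenvalue (hessian f x) a].

(* [alpha f t, beta f t] is the minimal interval containing the eigenvalues of
   the Hessian over the sublevel set.  On an empty or unbounded set, inf or sup
   takes the default value 0, so 0 < alpha f t <= beta f t also says that the
   set is nonempty and bounded. *)
Definition alpha (R : realType) (n : nat) (f : 'rV[R]_n -> R) (t : R) : R :=
  inf (hessian_eigenvalues f t).

Definition beta (R : realType) (n : nat) (f : 'rV[R]_n -> R) (t : R) : R :=
  sup (hessian_eigenvalues f t).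

Definition kappa (R : realType) (n : nat) (f : 'rV[R]_n -> R) (t : R) : R :=
  beta f t / alpha f t.

(* A division of the variables into d blocks of sizes m i is carried by the
   dimension \sum_i m i; the i-th block of x is then submxrow x i. *)

(* The vector (x^j, y): the j-th block of x is replaced by y. *)
Definition set_block (R : realType) (d : nat) (m : 'I_d -> nat)
    (x : 'rV[R]_(\sum_i m i)) (j : 'I_d) (y : 'rV[R]_(m j)) :
    'rV[R]_(\sum_i m i) :=
  \mxrow_i eqtype.dfwith (fun l => submxrow x l) y i.
Arguments set_block {R d m} x j y.

Definition block_grad (R : realType) (d : nat) (m : 'I_d -> nat)
    (f : 'rV[R]_(\sum_i m i) -> R) (x : 'rV[R]_(\sum_i m i)) (j : 'I_d) :
    'rV[R]_(m j) :=
  submxrow (grad f x) j.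

Definition partial_minimization_step (R : realType) (d : nat) (m : 'I_d -> nat)
    (f : 'rV[R]_(\sum_i m i) -> R) (x x' : 'rV[R]_(\sum_i m i)) : Prop :=
  exists j : 'I_d,
    (forall l : 'I_d, enorm (block_grad f x l) <= enorm (block_grad f x j)) /\
    exists y : 'rV[R]_(m j),
      unique (minimizer (fun z => f (set_block x j z))) y /\ x' = set_block x j y.

(* Main.v *)
Require Import Defs.
From HB Require Import structures.
From mathcomp Require Import all_boot all_order all_algebra.
From mathcomp Require Import all_classical all_reals all_analysis.
From mathcomp Require Import ring lra.
Import Order.TTheory GRing.Theory Num.Theory.
Import numFieldNormedType.Exports.
Local Open Scope classical_set_scope.
Local Open Scope ring_scope.

(** The gap f x - f x* and the gradient control each other on the sublevel set
    of x. Strong convexity with modulus alpha gives the Polyak-Lojasiewicz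
    inequality f x - f x* <= |grad f x|^2 / (2 alpha)
    ([gradient_dominates_gap]). In the other direction, minimizing over the
    block j does at least as well as the gradient step of length 1 / beta in
    that block, so one step gains at least |g_j|^2 / (2 beta), where g_j is the
    block gradient ([descent], [step_descent]). Since j maximizes the block
    gradients, |g_j|^2 is at least |grad f x|^2 / d, and even
    |grad f x|^2 / (d - 1) from the second step on, because the block minimized
    over last has zero gradient ([step_block_grad_eq0], [max_block_ge_null]).
    Together these make each step contract the gap by the factor
    1 - 1 / (d kappa), respectively 1 - 1 / ((d - 1) kappa)
    ([step_contraction]), and the inequalities of part (3) follow by induction,
    the one for distances being [quadratic_growth].

    All this rests on the identification of alpha and beta, defined through
    eigenvalues, with bounds of the quadratic form of the Hessian
    ([alpha_quad], [quad_beta]). It uses Schwarz's theorem ([hessian_sym]), the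
    variational characterization of extreme eigenvalues of symmetric matrices
    ([min_eigenvalue]) and compactness of sublevel sets ([sublevel_compact]).
    Monotonicity of alpha, beta and kappa along the iteration is inclusion of
    sublevel sets; their limits follow from continuity of the Hessian, since
    the sublevel sets shrink to the minimizer ([alpha_beta_near]). *)

(** * Directional derivatives of continuously differentiable functions *)

Lemma is_derive_cont {R : realType} (g dg : R -> R) :
  (forall s : R, is_derive s 1 g (dg s)) -> continuous g.
Proof.
move=> gd s; apply/differentiable_continuous/derivable1_diffP.
exact: (@ex_derive _ _ _ _ _ _ _ (gd s)).
Qed.

(** Increments from 0 in either direction, with the intermediate point given
    as a fraction of b. Difference quotients involve increments of both signs,
    and this form spares case distinctions on the sign of b. *)
Lemma MVT_from0 {R : realType} (g dg : R -> R) (b : R) :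
  (forall s : R, is_derive s 1 g (dg s)) ->
  exists2 th, 0 <= th <= 1 & g b - g 0 = dg (th * b) * b.
Proof.
move=> gd; have gc := is_derive_cont g dg gd.
have [b0|b0|<-] := ltgtP 0 b; last 1 first.
- by exists 0; rewrite ?lexx ?ler01// subrr mulr0.
- have [|c + eq] := @MVT R g dg 0 b b0 (fun s _ => gd s).
    exact: continuous_subspaceT.
  rewrite in_itv/= => /andP[c0 cb]; exists (c / b).
    by rewrite ler_pdivlMr// mul0r ler_pdivrMr// mul1r !ltW.
  by rewrite divfK ?gt_eqF// eq subr0.
- have [|c + eq] := @MVT R g dg b 0 b0 (fun s _ => gd s).
    exact: continuous_subspaceT.
  rewrite in_itv/= => /andP[bc c0]; exists (c / b).
    by rewrite ler_ndivlMr// mul0r ler_ndivrMr// mul1r !ltW.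
  by rewrite divfK ?lt_eqF// -opprB eq sub0r mulrN opprK.
Qed.

Lemma is_derive_line {R : realType} {V : normedModType R} (f : V -> R)
    (x v : V) (s d : R) :
  is_derive (x + s *: v) v f d -> is_derive s 1 (fun r => f (x + r *: v)) d.
Proof.
have E : (fun h : R => h^-1 *: (((fun r => f (x + r *: v)) \o shift s) (h *: 1)
     - f (x + s *: v))) =
  (fun h => h^-1 *: ((f \o shift (x + s *: v)) (h *: v) - f (x + s *: v))).
  apply/funext => h /=; congr (_ *: (f _ - _)).
  by rewrite [h *: 1]mulr1 scalerDl addrCA.
by move=> [H1 H2]; constructor; [rewrite /derivable E|rewrite /derive E].
Qed.

(** The inductive step from partial derivatives to arbitrary directions. The
    increment along h (w + c e) is the increment along h w followed by one along
    h c e; by the mean value theorem the latter is h c times a value of 'D_e f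
    at a point tending to x, hence h c 'D_e f x + o(h) by continuity. *)
Lemma is_derive_add_dir {R : realType} {V : normedModType R} (f : V -> R)
    (x w e : V) (c D : R) :
  is_derive x w f D -> (forall y, derivable f y e) ->
  {for x, continuous ('D_e f)} ->
  is_derive x (w + c *: e) f (D + c * 'D_e f x).
Proof.
move=> [dw <-] de ce.
suff H : (fun h => h^-1 *: ((f \o shift x) (h *: (w + c *: e)) - f x)) @ 0^'
    --> 'D_w f x + c * 'D_e f x.
  constructor; first by apply/cvg_ex; eexists; exact: H.
  exact: cvg_lim H.
have -> : (fun h => h^-1 *: ((f \o shift x) (h *: (w + c *: e)) - f x)) =
   (fun h => h^-1 *: ((f \o shift x) (h *: w) - f x)) \+
   (fun h => h^-1 *: (f (h *: w + x + (h * c) *: e) - f (h *: w + x))).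
  apply/funext => h /=; rewrite -scalerDr; congr (_ *: _).
  by rewrite scalerDr scalerA addrAC [RHS]addrC addrA subrK.
apply: cvgD; first exact: dw.
have line (h : R) : forall s : R,
    is_derive s 1 (fun r => f (h *: w + x + r *: e))
      ('D_e f (h *: w + x + s *: e)).
  by move=> s; apply: is_derive_line; apply: derivableP; exact: de.
apply/cvgrPdist_le => eps eps0.
have c1 : 0 < `|c| + 1 by rewrite ltr_wpDl.
have /cvgrPdist_le /(_ (eps / (`|c| + 1))) := ce.
rewrite divr_gt0// => /(_ isT)/nbhs_normP[/= del del0 Hdel].
pose M := `|w| + `|c| * `|e| + 1.
have M0 : 0 < M by rewrite ltr_wpDl// addr_ge0// mulr_ge0.
near=> h.
have h0 : h != 0 by near: h; exact: nbhs_dnbhs_neq.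
have [th /andP[th0 th1]] := MVT_from0 _ _ (h * c) (line h).
rewrite scale0r addr0 => ->.
have -> : h^-1 *: ('D_e f (h *: w + x + (th * (h * c)) *: e) * (h * c)) =
   c * 'D_e f (h *: w + x + (th * (h * c)) *: e).
  rewrite [_ *: _]mulrC; field; exact: h0.
rewrite -mulrBr normrM.
have /Hdel : ball_ (fun y : V => `|y|) x del (h *: w + x + (th * (h * c)) *: e).
  rewrite /ball_ /= -addrA addrCA opprD addrA subrr sub0r normrN.
  have hs : `|h| < del / M.
    near: h; apply: dnbhs0_lt; exact: divr_gt0.
  rewrite (le_lt_trans (ler_normD _ _))// !normrZ.
  apply: (@le_lt_trans _ _ (`|h| * M)); last by rewrite -ltr_pdivlMr.
  rewrite /M -addrA mulrDr lerD2l mulrDr mulrA.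
  rewrite ler_wpDr ?mulr_ge0// ger0_norm// -!mulrA.
  by rewrite ler_piMl// !mulr_ge0.
rewrite /= => H; apply: (@le_trans _ _ (`|c| * (eps / (`|c| + 1)))).
  by rewrite ler_wpM2l.
by rewrite mulrCA ler_piMr ?(ltW eps0)// ler_pdivrMr// mul1r lerDl.
Unshelve. all: by end_near. Qed.

Definition dot {R : realType} {n : nat} (u v : 'rV[R]_n) : R := (u *m v^T) 0 0.

Lemma dotE {R : realType} {n : nat} (u v : 'rV[R]_n) :
  dot u v = \sum_i u 0 i * v 0 i.
Proof. by rewrite /dot mxE; apply: eq_bigr => i _; rewrite mxE. Qed.

(** Adding one coordinate direction at a time with [is_derive_add_dir] gives
    every directional derivative of a C^1 function; Frechet differentiability
    is bypassed, since f is only ever studied along lines. *)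
Lemma C1_is_derive {R : realType} {n : nat} (f : 'rV[R]_n -> R) x v :
  C1 f -> is_derive x v f (dot (grad f x) v).
Proof.
move=> [_ fC].
rewrite [v in is_derive _ v]row_sum_delta dotE.
have -> : \sum_i grad f x 0 i * v 0 i = \sum_i v 0 i * partial i f x.
  by apply: eq_bigr => i _; rewrite mxE mulrC.
elim/big_rec2 : _ => [|i d w _ dw]; first exact: is_derive0.
rewrite addrC [X in is_derive _ _ _ X]addrC.
apply: is_derive_add_dir => //; first exact: (fC i).1.
exact: (fC i).2.
Qed.

(** * Second-order Taylor bounds and symmetry of the Hessian *)

Definition quad {R : realType} {n : nat} (A : 'M[R]_n) (v : 'rV[R]_n) : R :=
  (v *m A *m v^T) 0 0.

(** Two applications of the mean value theorem: g minus its quadratic minorant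
    has derivative dg s - dg 0 - c s, which is nonnegative because ddg >= c. *)
Lemma taylor2_ge {R : realType} (g dg ddg : R -> R) (c : R) :
  (forall s : R, is_derive s 1 g (dg s)) ->
  (forall s : R, is_derive s 1 dg (ddg s)) ->
  (forall s, 0 <= s <= 1 -> c <= ddg s) -> g 0 + dg 0 + c / 2 <= g 1.
Proof.
move=> gd dgd cd.
pose h (s : R) := g s - (dg 0 * s + c / 2 * s ^+ 2).
have hd (s : R) : is_derive s 1 h (dg s - (dg 0 + c * s)).
  have -> : dg s - (dg 0 + c * s) =
      dg s - (dg 0 *: 1 + (c / 2) *: (2%:R *: s ^+ 1 *: 1)).
    by rewrite /GRing.scale /=; field.
  apply: is_deriveB; apply: is_deriveD.
  apply: is_deriveZ; rewrite -(exp_derive 2 s 1).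
  exact/derivableP/exprn_derivable.
have [th /andP[th0 th1]] := MVT_from0 h _ 1 hd.
have [u /andP[u0 u1]] := MVT_from0 dg _ th dgd.
have : c <= ddg (u * th) by apply: cd; rewrite mulr_ge0//= mulr_ile1.
rewrite /h !mulr1 => H1 E1 E2.
have : c * th <= ddg (u * th) * th by rewrite ler_wpM2r.
lra.
Qed.

(** Two functions that take a common value at points arbitrarily close to x,
    possibly different for each of them, agree at x when both are continuous
    there. This isolates the limit in the proof of Schwarz's theorem. *)
Lemma eq_of_near_values {R : realType} {V : normedModType R} (A B : V -> R)
    (x : V) (M : R) :
  {for x, continuous A} -> {for x, continuous B} ->
  (forall h : R, 0 < h -> exists2 y1, `|y1 - x| <= `|h| * M &
     exists2 y2, `|y2 - x| <= `|h| * M & A y1 = B y2) ->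
  A x = B x.
Proof.
move=> cA cB H.
apply/eqP; rewrite -subr_eq0 -normr_le0; apply/ler_addgt0Pr => eps eps0.
rewrite add0r.
have e2 : 0 < eps / 2 by rewrite divr_gt0.
have cont (F : V -> R) : {for x, continuous F} -> exists2 r, 0 < r &
    forall y, `|y - x| < r -> `|F x - F y| < eps / 2.
  move=> /cvgrPdist_lt /(_ _ e2) /nbhs_normP[r /= r0 Hr]; exists r => // y yx.
  by apply: Hr; rewrite /= distrC.
have [r1 r10 H1] := cont A cA; have [r2 r20 H2] := cont B cB.
have r0 : 0 < Num.min r1 r2 by rewrite lt_min r10.
have M0 : 0 < `|M| + 1 by rewrite ltr_wpDl.
pose h := Num.min r1 r2 / 2 / (`|M| + 1).
have h0 : 0 < h by rewrite !divr_gt0.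
have hM : `|h| * M < Num.min r1 r2.
  apply: (@le_lt_trans _ _ (h * (`|M| + 1))).
    rewrite gtr0_norm// ler_pM2l// (le_trans (ler_norm M))// lerDl.
    exact: ler01.
  by rewrite divfK ?gt_eqF// ltr_pdivrMr// ltr_pMr ?ltr1n.
have [y1 y1x [y2 y2x E]] := H h h0.
have := le_lt_trans y1x hM; rewrite lt_min => /andP[/H1 {}H1 _].
have := le_lt_trans y2x hM; rewrite lt_min => /andP[_ /H2 {}H2].
have -> : A x - B x = (A x - A y1) - (B x - B y2) by rewrite E; ring.
apply: le_trans (ler_normB _ _) _; rewrite [leRHS]splitr.
exact: lerD (ltW H1) (ltW H2).
Qed.

Section C2_calculus.
Context {R : realType} {n : nat} (f : 'rV[R]_n -> R) (fC2 : C2 f).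

Lemma is_derive_dot_grad (x v w : 'rV[R]_n) :
  is_derive x v (fun y => dot (grad f y) w) ((v *m hessian f x *m w^T) 0 0).
Proof.
have -> : (fun y => dot (grad f y) w) =
    \sum_i (w 0 i *: (partial i f : 'rV[R]_n -> R)).
  apply/funext => y; rewrite dotE fct_sumE; apply: eq_bigr => i _.
  by rewrite mxE mulrC.
have -> : (v *m hessian f x *m w^T) 0 0 =
    \sum_i (w 0 i *: dot (grad (partial i f) x) v).
  rewrite mxE; apply: eq_bigr => i _; rewrite !mxE mulrC; congr (_ * _).
  by rewrite dotE; apply: eq_bigr => j _; rewrite !mxE mulrC.
apply: is_derive_sum => i; apply: is_deriveZ.
exact: (C1_is_derive _ _ _ (fC2.2 i)).
Qed.

(** The mixed second difference over the square of side h is invariant under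
    exchange of i and j up to the order of its terms, and applying the mean
    value theorem in direction j and then i turns it into a mixed partial
    derivative at a nearby point. *)
Lemma second_difference (x : 'rV[R]_n) (i j : 'I_n) (h : R) :
  let e : 'rV[R]_n := delta_mx 0 i in let e' : 'rV[R]_n := delta_mx 0 j in
  exists2 y, `|y - x| <= `|h| * (`|e| + `|e'|) &
    f (x + h *: e + h *: e') - f (x + h *: e) - f (x + h *: e') + f x =
    h ^+ 2 * partial i (partial j f) y.
Proof.
move=> e e'.
pose phi (s : R) := f (x + h *: e + s *: e') - f (x + s *: e').
pose dphi (s : R) :=
  partial j f (x + h *: e + s *: e') - partial j f (x + s *: e').
have phid (s : R) : is_derive s 1 phi (dphi s).
  apply: is_deriveB; apply: is_derive_line; apply: derivableP.
    exact: (fC2.1.2 j).1.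
  exact: (fC2.1.2 j).1.
have [th /andP[th0 th1] E1] := MVT_from0 _ _ h phid.
pose z := x + (th * h) *: e'.
have psid (s : R) : is_derive s 1 (fun r => partial j f (z + r *: e))
    (partial i (partial j f) (z + s *: e)).
  by apply: is_derive_line; apply: derivableP; exact: ((fC2.2 j).2 i).1.
have [u /andP[u0 u1] E2] := MVT_from0 _ _ h psid.
exists (z + (u * h) *: e).
  rewrite /z addrAC [x + _ - x]addrAC subrr add0r addrC mulrDr.
  rewrite (le_trans (ler_normD _ _))// !normrZ (ger0_norm th0).
  rewrite (ger0_norm u0) -!mulrA.
  by rewrite lerD// ler_piMl// mulr_ge0.
rewrite expr2 -mulrA [h * partial _ _ _]mulrC -E2 scale0r addr0.
have -> : z + h *: e = x + h *: e + (th * h) *: e' by rewrite /z addrAC.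
move: E1; rewrite /phi /dphi /z scale0r !addr0 [_ * h]mulrC => <-.
ring.
Qed.

(** Schwarz's theorem: both mixed partial derivatives compute the same second
    difference. Symmetry is what lets real eigenvalues control the quadratic
    form of the Hessian. *)
Lemma hessian_sym (x : 'rV[R]_n) : (hessian f x)^T = hessian f x.
Proof.
apply/matrixP => i j; rewrite !mxE.
pose M := `|delta_mx 0 i : 'rV[R]_n| + `|delta_mx 0 j : 'rV[R]_n|.
apply: (@eq_of_near_values _ _ _ _ x M); first exact: ((fC2.2 i).2 j).2.
  exact: ((fC2.2 j).2 i).2.
move=> h h0.
have [y1 y1x E1] := second_difference x j i h.
have [y2 y2x E2] := second_difference x i j h.
exists y1; first by move: y1x; rewrite [X in _ * X]addrC.
exists y2; first exact: y2x.
apply: (mulfI (x := h ^+ 2)); first by rewrite expf_neq0// gt_eqF.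
apply: etrans (esym E1) (etrans _ E2).
by rewrite [f _ - f _ - f _]addrAC [x + _ + _]addrAC.
Qed.

(** The quadratic form of the Hessian has to be bounded only along the segment
    from x to x + v. This matters because uniform bounds are available only on
    sublevel sets, which are convex. *)
Lemma taylor_ge (x v : 'rV[R]_n) (c : R) :
  (forall s, 0 <= s <= 1 -> c <= quad (hessian f (x + s *: v)) v) ->
  f x + dot (grad f x) v + c / 2 <= f (x + v).
Proof.
move=> cq.
pose g (s : R) := f (x + s *: v).
pose dg (s : R) := dot (grad f (x + s *: v)) v.
have := taylor2_ge g dg (fun s => quad (hessian f (x + s *: v)) v) c _ _ cq.
rewrite /g /dg scale0r addr0 scale1r; apply => s.
  by apply: is_derive_line; apply: C1_is_derive; exact: fC2.1.
exact: (is_derive_line (fun y => dot (grad f y) v) _ _ _ _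
  (is_derive_dot_grad _ _ _)).
Qed.

Lemma taylor_le (x v : 'rV[R]_n) (c : R) :
  (forall s, 0 <= s <= 1 -> quad (hessian f (x + s *: v)) v <= c) ->
  f (x + v) <= f x + dot (grad f x) v + c / 2.
Proof.
move=> cq.
pose g (s : R) := - f (x + s *: v).
pose dg (s : R) := - dot (grad f (x + s *: v)) v.
have := taylor2_ge g dg (fun s => - quad (hessian f (x + s *: v)) v) (- c).
rewrite /g /dg scale0r addr0 scale1r -subr_ge0 => H.
rewrite -subr_ge0; apply: le_trans (H _ _ _) _; last lra.
- move=> s; apply: is_deriveN.
  by apply: is_derive_line; apply: C1_is_derive; exact: fC2.1.
- move=> s; apply: is_deriveN.
  exact: (is_derive_line (fun y => dot (grad f y) v) _ _ _ _
    (is_derive_dot_grad _ _ _)).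
- by move=> s s01; rewrite lerN2 cq.
Qed.

End C2_calculus.

(** * Quadratic forms and extreme eigenvalues *)

Section dot_quad.
Context {R : realType} {n : nat}.
Implicit Types (u v w : 'rV[R]_n) (A : 'M[R]_n).

Lemma quadE A v : quad A v = \sum_j (\sum_i v 0 i * A i j) * v 0 j.
Proof. by rewrite /quad mxE; apply: eq_bigr => i _; rewrite !mxE. Qed.

Lemma dotC u v : dot u v = dot v u.
Proof. by rewrite !dotE; apply: eq_bigr => i _; rewrite mulrC. Qed.

Lemma dotZr u a v : dot u (a *: v) = a * dot u v.
Proof. by rewrite /dot linearZ/= -scalemxAr mxE. Qed.

Lemma dotDr u v w : dot u (v + w) = dot u v + dot u w.
Proof. by rewrite /dot linearD/= mulmxDr !mxE. Qed.

Lemma dot_sqrD u v a :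
  dot (u + a *: v) (u + a *: v) = dot u u + 2 * a * dot u v + a ^+ 2 * dot v v.
Proof.
rewrite dotDr dotZr [dot (u + _) u]dotC [dot (u + _) v]dotC !dotDr !dotZr.
rewrite [dot v u]dotC; ring.
Qed.

Lemma dotvv_ge0 v : 0 <= dot v v.
Proof. by rewrite dotE sumr_ge0// => i _; rewrite -expr2 sqr_ge0. Qed.

Lemma dotvv_eq0 v : (dot v v == 0) = (v == 0).
Proof.
apply/idP/eqP => [|->]; last by rewrite dotE big1// => i _; rewrite mxE mul0r.
rewrite dotE psumr_eq0 => [/allP H|i _]; last by rewrite -expr2 sqr_ge0.
apply/rowP => i; rewrite mxE; apply/eqP.
by have := H i (mem_index_enum _); rewrite -expr2 sqrf_eq0.
Qed.

Lemma dotvv_gt0 v : (0 < dot v v) = (v != 0).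
Proof. by rewrite lt_def dotvv_ge0 andbT dotvv_eq0. Qed.

Lemma enorm_sqr v : enorm v ^+ 2 = dot v v.
Proof.
rewrite /enorm sqr_sqrtr ?sumr_ge0// => [|i _]; last exact: sqr_ge0.
by rewrite dotE; apply: eq_bigr => i _; rewrite expr2.
Qed.

Lemma enorm_ge0 v : 0 <= enorm v.
Proof. exact: sqrtr_ge0. Qed.

Lemma coord_le_enorm v k : `|v 0 k| <= enorm v.
Proof.
rewrite -(@ler_pXn2r _ 2)// ?nnegrE ?enorm_ge0// enorm_sqr.
rewrite real_normK ?num_real// dotE (bigD1 k)//= expr2 lerDl.
by rewrite sumr_ge0// => l _; rewrite -expr2 sqr_ge0.
Qed.

Lemma quadZ A a v : quad A (a *: v) = a ^+ 2 * quad A v.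
Proof.
by rewrite /quad linearZ/= -!scalemxAl -scalemxAr !mxE mulrA -expr2.
Qed.

Lemma dotNr u v : dot u (- v) = - dot u v.
Proof. by rewrite -scaleN1r dotZr mulN1r. Qed.

Lemma quad0 A : quad A 0 = 0.
Proof. by rewrite /quad !mul0mx mxE. Qed.

Lemma dot0r u : dot u 0 = 0.
Proof. by rewrite /dot trmx0 mulmx0 mxE. Qed.

Lemma quadN A v : quad (- A) v = - quad A v.
Proof. by rewrite /quad mulmxN mulNmx mxE. Qed.

Lemma quadB A B v : quad (A - B) v = quad A v - quad B v.
Proof. by rewrite /quad mulmxBr mulmxBl [LHS]mxE [X in _ + X = _]mxE. Qed.

Lemma quad_sub_scalar A a v : quad (A - a%:M) v = quad A v - a * dot v v.
Proof.
by rewrite quadB /quad /dot mul_mx_scalar -scalemxAl [X in _ - X = _]mxE.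
Qed.

Lemma dot_mulmx A u v : A^T = A -> dot (u *m A) v = dot (v *m A) u.
Proof.
move=> As; rewrite /dot -{2}As -[in RHS](trmxK (v *m A^T *m u^T)) trmx_mul.
by rewrite [in RHS]mxE trmx_mul trmxK trmxK mulmxA.
Qed.

Lemma quadD A u v : A^T = A ->
  quad A (u + v) = quad A u + 2 * dot (u *m A) v + quad A v.
Proof.
move=> As; rewrite /quad linearD/= mulmxDl mulmxDr !mulmxDl.
have := dot_mulmx A u v As; rewrite /dot mxE !mxE => E.
rewrite E; lra.
Qed.

End dot_quad.

Lemma quad_continuous {R : realType} {T : topologicalType} {n : nat}
    (H : T -> 'M[R]_n) (v : T -> 'rV[R]_n) :
  (forall i j, continuous (fun t => H t i j)) ->
  (forall i, continuous (fun t => v t 0 i)) ->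
  continuous (fun t => quad (H t) (v t)).
Proof.
move=> cH cv.
have -> : (fun t => quad (H t) (v t)) =
    (fun t => \sum_j (\sum_i v t 0 i * H t i j) * v t 0 j).
  by apply/funext => t; rewrite quadE.
apply: (continuous_big add_continuous) => j _ t; apply: continuousM;
  last exact: cv.
apply: (continuous_big add_continuous) => i _ s; apply: continuousM;
  [exact: cv|exact: cH].
Qed.

(** Any norm of the difference would do; the sum of the absolute values of the
    entries is continuous for evident reasons. *)
Lemma quad_dist_le {R : realType} {n : nat} (A B : 'M[R]_n) (v : 'rV[R]_n) :
  `|quad A v - quad B v| <= (\sum_j \sum_i `|A i j - B i j|) * dot v v.
Proof.
have -> : \sum_j \sum_i `|A i j - B i j| = \sum_j \sum_i `|(A - B) i j|.
  by apply: eq_bigr => j _; apply: eq_bigr => i _; rewrite !mxE.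
rewrite -quadB; move: (A - B) => {B}A.
rewrite quadE mulr_suml (le_trans (ler_norm_sum _ _ _))// ler_sum// => j _.
rewrite normrM mulr_suml (le_trans (ler_wpM2r _ (ler_norm_sum _ _ _)))//.
rewrite mulr_suml ler_sum// => i _.
rewrite normrM mulrAC mulrC ler_wpM2l//.
by rewrite -enorm_sqr expr2 ler_pM// coord_le_enorm.
Qed.

Lemma dot_continuous {R : realType} {n : nat} :
  continuous (fun v : 'rV[R]_n => dot v v).
Proof.
have -> : (fun v : 'rV[R]_n => dot v v) =
    (fun v => \sum_i (v 0 i * v 0 i)) by apply/funext => v; rewrite dotE.
by apply: (continuous_big add_continuous) => i _ t; apply: continuousM;
  exact: coord_continuous.
Qed.

(** The topology of the space of row vectors comes from the sup norm; this
    comparison transfers Euclidean bounds to it. *)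
Lemma norm_le_enorm {R : realType} {n : nat} (v : 'rV[R]_n) : `|v| <= enorm v.
Proof.
rewrite -[`|v|]/(mx_norm v) mx_normrE; apply/bigmax_leP; split => [|[i j] _ /=].
  exact: enorm_ge0.
by rewrite (ord1 i) coord_le_enorm.
Qed.

Lemma enorm_le_compact {R : realType} {n : nat} (A : set 'rV[R]_n) (M : R) :
  closed A -> (forall v, A v -> enorm v <= M) -> compact A.
Proof.
move=> cA AM; apply: bounded_closed_compact => //.
exists M; split; first exact: num_real.
move=> N MN v Av; rewrite /= (le_trans (norm_le_enorm v))//.
by rewrite (le_trans (AM _ Av))// ltW.
Qed.

Definition usphere {R : realType} {n : nat} : set 'rV[R]_n :=
  [set v | dot v v = 1].

Lemma usphere_compact {R : realType} {n : nat} : compact (@usphere R n).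
Proof.
apply: (enorm_le_compact _ 1) => [|v v1]; last first.
  by rewrite -(@ler_pXn2r _ 2)// ?nnegrE ?enorm_ge0// enorm_sqr v1 expr1n.
have -> : @usphere R n =
  (fun v : 'rV[R]_n => dot v v) @^-1` [set x | x = 1] by [].
apply: preimage_closed; last exact: closed_eq.
by move=> v _; exact: dot_continuous.
Qed.

Lemma usphere_nonempty {R : realType} {n : nat} :
  (0 < n)%N -> @usphere R n !=set0.
Proof.
case: n => // n _; exists (delta_mx 0 0).
rewrite /usphere /= dotE (bigD1 0)//= !mxE eqxx mulr1 big1 ?addr0// => i i0.
by rewrite mxE (negbTE i0) mul0r.
Qed.

Lemma usphere_scale {R : realType} {n : nat} (v : 'rV[R]_n) :
  v != 0 -> exists2 u, usphere u & v = enorm v *: u.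
Proof.
move=> v0; have e0 : enorm v != 0.
  by rewrite -sqrf_eq0 enorm_sqr dotvv_eq0.
exists ((enorm v)^-1 *: v); last by rewrite scalerA divff ?scale1r.
rewrite /usphere /= dotZr dotC dotZr mulrA -enorm_sqr -expr2 exprVn.
by rewrite mulVf// sqrf_eq0.
Qed.

Lemma quad_ge_usphere {R : realType} {n : nat} (A : 'M[R]_n) (a : R) :
  (forall u, usphere u -> a <= quad A u) -> forall v, a * dot v v <= quad A v.
Proof.
move=> H v; have [->|v0] := eqVneq v 0.
  by rewrite quad0 dot0r mulr0.
have [u us ->] := usphere_scale v v0.
rewrite quadZ dotZr dotC dotZr us mulr1 -expr2 mulrC ler_wpM2l ?sqr_ge0//.
exact: H.
Qed.

Lemma eigenvalue_quad {R : realType} {n : nat} (A : 'M[R]_n) a :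
  eigenvalue A a -> exists2 v, v != 0 & quad A v = a * dot v v.
Proof.
move=> /eigenvalueP[v vA v0]; exists v => //.
by rewrite /quad vA -scalemxAl mxE.
Qed.

(** Variational characterization of the least eigenvalue. The quadratic form
    attains its minimum a on the unit sphere at some u; then A - a is positive
    semidefinite with vanishing form at u, which forces u (A - a) = 0. *)
Lemma min_eigenvalue {R : realType} {n : nat} (A : 'M[R]_n) :
  (0 < n)%N -> A^T = A ->
  exists2 a, eigenvalue A a & forall v, a * dot v v <= quad A v.
Proof.
move=> n0 As.
have [|u] := compact_EVT_min (f := quad A) (usphere_nonempty n0)
    usphere_compact.
  apply: continuous_subspaceT; apply: (quad_continuous (fun=> A) id) => [i j|i].
    exact: cst_continuous.
  exact: coord_continuous.
rewrite inE => us umin; exists (quad A u); last first.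
  by apply: quad_ge_usphere => v vs; apply: umin; rewrite inE.
set a := quad A u.
have aq v : 0 <= quad (A - a%:M) v.
  rewrite quad_sub_scalar subr_ge0; apply: quad_ge_usphere => w ws.
  by apply: umin; rewrite inE.
set B := A - a%:M.
have Bs : B^T = B by rewrite /B linearB/= As tr_scalar_mx.
have Bu : quad B u = 0 by rewrite quad_sub_scalar us mulr1 subrr.
apply/eigenvalueP; exists u; last first.
  by rewrite -dotvv_eq0 us oner_eq0.
apply/eqP; rewrite -subr_eq0 -mul_mx_scalar -mulmxBr -/B -dotvv_eq0.
set w := u *m B; set b := dot w w; set c := quad B w.
have c0 : 0 <= c := aq w.
have b0 : 0 <= b := dotvv_ge0 w.
(* A step from u against its residual w, with length of the order b / c, makes
   the first-order term 2 s b of the form beat the second-order term s^2 c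
   unless b = 0. *)
have := aq (u + (- (b / (c + 1))) *: w).
rewrite quadD// -/B Bu dotZr -/w -/b quadZ -/c add0r => H.
have c1 : 0 < c + 1 by rewrite ltr_wpDl.
suff : b ^+ 2 <= 0 by rewrite -sqrf_eq0 eq_le sqr_ge0 => ->.
set s := - (b / (c + 1)) in H.
have : 0 <= (c + 1) ^+ 2 * (2 * (s * b) + s ^+ 2 * c).
  by rewrite mulr_ge0// sqr_ge0.
have -> : (c + 1) ^+ 2 * (2 * (s * b) + s ^+ 2 * c) = - (b ^+ 2 * (c + 2)).
  by rewrite /s; field; exact: lt0r_neq0.
rewrite oppr_ge0 pmulr_lle0//; lra.
Qed.

Lemma max_eigenvalue {R : realType} {n : nat} (A : 'M[R]_n) :
  (0 < n)%N -> A^T = A ->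
  exists2 a, eigenvalue A a & forall v, quad A v <= a * dot v v.
Proof.
move=> n0 As; have [|a /eigenvalueP[v va v0] aq] := min_eigenvalue (- A) n0.
  by rewrite linearN/= As.
exists (- a); last by move=> w; rewrite mulNr lerNr -quadN.
by apply/eigenvalueP; exists v => //; rewrite scaleNr -va mulmxN opprK.
Qed.

(** * Convex functions with positive definite Hessian *)

Lemma closed_sublevel {R : realType} {T : topologicalType}
    (f : T -> R) (t : R) : continuous f -> closed [set y | f y <= t].
Proof.
move=> cf; have -> : [set y | f y <= t] = f @^-1` [set r | r <= t] by [].
by apply: preimage_closed; [move=> y _; exact: cf|exact: closed_le].
Qed.

Lemma grad_dot_eq0 {R : realType} {n : nat} (f : 'rV[R]_n -> R)
    (x v : 'rV[R]_n) :
  C1 f -> (forall s, f x <= f (x + s *: v)) -> dot (grad f x) v = 0.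
Proof.
move=> fC1 xmin.
have gd (s : R) : is_derive s 1 (fun r => f (x + r *: v))
    (dot (grad f (x + s *: v)) v).
  by apply: is_derive_line; exact: C1_is_derive.
have [|s s1||s s1|_] := @derive1_at_min R (fun r => f (x + r *: v)) (-1) 1 0.
- by rewrite (le_trans (lerN10 R)).
- exact: (@ex_derive _ _ _ _ _ _ _ (gd s)).
- by rewrite in_itv/= ltrN10 ltr01.
- by rewrite scale0r addr0.
by rewrite (@derive_val _ _ _ _ _ _ _ (gd 0)) scale0r addr0.
Qed.

Section convex_calculus.
Context {R : realType} {n : nat} (f : 'rV[R]_n -> R).
Context (fC2 : C2 f) (fconv : forall x, pos_def (hessian f x)).

Lemma tangent_le (x v : 'rV[R]_n) : f x + dot (grad f x) v <= f (x + v).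
Proof.
have := taylor_ge f fC2 x v 0; rewrite mul0r addr0; apply => s _.
have [->|v0] := eqVneq v 0; last exact/ltW/fconv.
by rewrite quad0.
Qed.

Lemma convex_seg (x v : 'rV[R]_n) (s : R) : 0 <= s <= 1 ->
  f (x + s *: v) <= (1 - s) * f x + s * f (x + v).
Proof.
move=> /andP[s0 s1]; set z := x + s *: v.
have H1 := tangent_le z (- s *: v); have H2 := tangent_le z ((1 - s) *: v).
rewrite !dotZr in H1 H2.
have E1 : z + - s *: v = x by rewrite /z scaleNr addrK.
have E2 : z + (1 - s) *: v = x + v.
  by rewrite /z -addrA -scalerDl addrC [s + _]addrC subrK scale1r addrC.
rewrite E1 in H1; rewrite E2 in H2.
set D := dot _ _ in H1 H2.
have G1 : (1 - s) * (f z + - s * D) <= (1 - s) * f x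
  by rewrite ler_wpM2l ?subr_ge0.
have G2 : s * (f z + (1 - s) * D) <= s * f (x + v) by rewrite ler_wpM2l.
lra.
Qed.

Lemma sublevel_seg (t : R) (x v : 'rV[R]_n) (s : R) : 0 <= s <= 1 ->
  sublevel f t x -> sublevel f t (x + v) -> sublevel f t (x + s *: v).
Proof.
rewrite /sublevel /= => s01 fx fxv; apply: le_trans (convex_seg _ _ _ s01) _.
case/andP: s01 => s0 s1.
have : (1 - s) * f x <= (1 - s) * t by rewrite ler_wpM2l ?subr_ge0.
have : s * f (x + v) <= s * t by rewrite ler_wpM2l.
lra.
Qed.

Lemma f_continuous : continuous f.
Proof. exact: fC2.1.1. Qed.

Context (n0 : (0 < n)%N).
Context (xs : 'rV[R]_n) (xs_min : unique (minimizer f) xs).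

(** On the unit sphere around the minimizer f exceeds its minimum by some
    del > 0, by compactness and uniqueness; convexity makes this excess grow at
    least linearly along rays, so sublevel sets are bounded. *)
Lemma sublevel_compact (t : R) : compact (sublevel f t).
Proof.
have cshift : continuous (fun v => f (xs + v)).
  move=> v; apply: (@continuous_comp _ _ _ (fun v => xs + v));
    last exact: f_continuous.
  by apply: continuousD; [exact: cst_continuous|exact: cvg_id].
have [|u] := compact_EVT_min (usphere_nonempty n0) usphere_compact
    (f := fun v => f (xs + v)).
  exact: continuous_subspaceT.
rewrite inE => us umin.
pose del := f (xs + u) - f xs.
have del0 : 0 < del.
  rewrite subr_gt0 lt_neqAle xs_min.1 andbT; apply/eqP => E.
  have : xs = xs + u by apply: xs_min.2 => z; rewrite -E; exact: xs_min.1.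
  rewrite -[LHS]addr0 => /addrI u0.
  by have := us; rewrite /usphere /= -u0 dot0r => /esym/eqP; rewrite oner_eq0.
pose W := [set v | f (xs + v) <= t].
have cW : compact W.
  apply: (@enorm_le_compact _ _ _ (Num.max 1 ((t - f xs) / del))).
    exact: closed_sublevel.
  move=> v Wv; rewrite le_max; have [//|e1] := leP (enorm v) 1.
  apply/orP; right.
  have v0 : v != 0.
    apply: contraTneq e1 => ->; rewrite -leNgt.
    rewrite -(@ler_pXn2r _ 2)// ?nnegrE ?enorm_ge0//.
    by rewrite enorm_sqr dot0r expr1n.
  have [w ws vE] := usphere_scale v v0.
  have e0 : 0 < enorm v := lt_trans ltr01 e1.
  have sw : (enorm v)^-1 *: v = w
    by rewrite {2}vE scalerA mulVf ?scale1r// gt_eqF.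
  have := convex_seg xs v (enorm v)^-1.
  rewrite sw invr_ge0 ltW//= invf_le1// => /(_ (ltW e1)).
  have := umin w; rewrite inE => /(_ ws) Huw Hc.
  rewrite ler_pdivlMr//.
  have Hd : del <= (enorm v)^-1 * (f (xs + v) - f xs) by rewrite /del; lra.
  have : enorm v * del <= f (xs + v) - f xs by rewrite -ler_pdivlMl.
  move=> /le_trans; apply; rewrite lerD2r; exact: Wv.
have -> : sublevel f t = (fun v => xs + v) @` W.
  apply/seteqP; split => [y yt|_ [v Wv <-]]; last exact: Wv.
  exists (y - xs); last by rewrite addrC subrK.
  by rewrite /W /= addrC subrK.
apply: continuous_compact => //; apply: continuous_subspaceT => v.
by apply: continuousD; [exact: cst_continuous|exact: cvg_id].
Qed.

Lemma hessian_continuous i j : continuous (fun y => hessian f y i j).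
Proof.
have -> : (fun y => hessian f y i j) = partial i (partial j f).
  by apply/funext => y; rewrite mxE.
exact: ((fC2.2 j).2 i).2.
Qed.

Lemma quad_hessian_continuous :
  continuous (fun p : 'rV[R]_n * 'rV[R]_n => quad (hessian f p.1) p.2).
Proof.
apply: quad_continuous => [i j p|i p].
  by apply: (@continuous_comp _ _ _ fst (fun y => hessian f y i j));
    [exact: cvg_fst|exact: hessian_continuous].
by apply: (@continuous_comp _ _ _ snd (fun v : 'rV[R]_n => v 0 i));
  [exact: cvg_snd|exact: coord_continuous].
Qed.

(** Extreme values over the compact product of the sublevel set with the unit
    sphere: the positivity of the Hessian is uniform on sublevel sets. *)
Lemma quad_hessian_bounds (t : R) : f xs <= t ->
  exists mu M, [/\ 0 < mu,
    forall y v, sublevel f t y -> mu * dot v v <= quad (hessian f y) v &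
    forall y v, sublevel f t y -> quad (hessian f y) v <= M * dot v v].
Proof.
move=> xst.
pose K := sublevel f t `*` @usphere R n.
have cK : compact K.
  by apply: compact_setX; [exact: sublevel_compact|exact: usphere_compact].
have K0 : K !=set0.
  have [u us] := @usphere_nonempty R n n0.
  by exists (xs, u); split.
have cQ : {within K, continuous
    (fun p : 'rV[R]_n * 'rV[R]_n => quad (hessian f p.1) p.2)}.
  apply: continuous_subspaceT; exact: quad_hessian_continuous.
have [[y0 v0]] := compact_EVT_min K0 cK cQ; rewrite inE => -[/= _ v0s] mmin.
have [p1 _ mmax] := compact_EVT_max K0 cK cQ.
exists (quad (hessian f y0) v0), (quad (hessian f p1.1) p1.2); split.
- apply: fconv; rewrite -dotvv_eq0 v0s; exact: oner_neq0.
- move=> y v yt; apply: quad_ge_usphere => u us; apply: (mmin (y, u)).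
  by rewrite inE; split.
- move=> y v yt; rewrite -lerN2 -mulNr -[- quad _ v]quadN.
  apply: quad_ge_usphere => u us.
  by rewrite quadN lerN2; apply: (mmax (y, u)); rewrite inE; split.
Qed.

Lemma hessian_eigenvalues_nonempty (t : R) : f xs <= t ->
  hessian_eigenvalues f t !=set0.
Proof.
move=> xst.
have [a ea _] := min_eigenvalue (hessian f xs) n0 (hessian_sym f fC2 xs).
by exists a; exists xs.
Qed.

Lemma has_lbound_hessian_eigenvalues (t : R) : f xs <= t ->
  exists2 mu, 0 < mu & lbound (hessian_eigenvalues f t) mu.
Proof.
move=> xst; have [mu [M [mu0 Hmu _]]] := quad_hessian_bounds t xst.
exists mu => // a [y yt /eigenvalue_quad[v v0 E]].
by have := Hmu y v yt; rewrite E ler_pM2r// dotvv_gt0.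
Qed.

Lemma has_ubound_hessian_eigenvalues (t : R) : f xs <= t ->
  has_ubound (hessian_eigenvalues f t).
Proof.
move=> xst; have [mu [M [_ _ HM]]] := quad_hessian_bounds t xst.
exists M => a [y yt /eigenvalue_quad[v v0 E]].
by have := HM y v yt; rewrite E ler_pM2r// dotvv_gt0.
Qed.

Lemma alpha_gt0 (t : R) : f xs <= t -> 0 < alpha f t.
Proof.
move=> xst; have [mu mu0 lmu] := has_lbound_hessian_eigenvalues t xst.
apply: lt_le_trans mu0 _; apply: lb_le_inf => //.
exact: hessian_eigenvalues_nonempty.
Qed.

Lemma alpha_le_eigenvalue (t a : R) : f xs <= t ->
  hessian_eigenvalues f t a -> alpha f t <= a.
Proof.
move=> xst; have [mu mu0 lmu] := has_lbound_hessian_eigenvalues t xst.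
by apply: ge_inf; exists mu.
Qed.

Lemma eigenvalue_le_beta (t a : R) : f xs <= t ->
  hessian_eigenvalues f t a -> a <= beta f t.
Proof.
by move=> xst; apply: ub_le_sup; exact: has_ubound_hessian_eigenvalues.
Qed.

Lemma alpha_le_beta (t : R) : f xs <= t -> alpha f t <= beta f t.
Proof.
move=> xst; have [a ha] := hessian_eigenvalues_nonempty t xst.
by apply: (@le_trans _ _ a);
  [exact: alpha_le_eigenvalue|exact: eigenvalue_le_beta].
Qed.

Lemma beta_gt0 (t : R) : f xs <= t -> 0 < beta f t.
Proof.
by move=> xst; rewrite (lt_le_trans (alpha_gt0 t xst))// alpha_le_beta.
Qed.

(** The infimum of the eigenvalues over the sublevel set bounds the quadratic
    form there, because at each point the form is bounded below by an actual
    eigenvalue. *)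
Lemma alpha_quad (t : R) (y v : 'rV[R]_n) : f xs <= t -> sublevel f t y ->
  alpha f t * dot v v <= quad (hessian f y) v.
Proof.
move=> xst yt.
have [a ea aq] := min_eigenvalue (hessian f y) n0 (hessian_sym f fC2 y).
apply: le_trans (aq v); rewrite ler_wpM2r ?dotvv_ge0//.
by apply: alpha_le_eigenvalue => //; exists y.
Qed.

Lemma quad_beta (t : R) (y v : 'rV[R]_n) : f xs <= t -> sublevel f t y ->
  quad (hessian f y) v <= beta f t * dot v v.
Proof.
move=> xst yt.
have [a ea aq] := max_eigenvalue (hessian f y) n0 (hessian_sym f fC2 y).
apply: le_trans (aq v) _; rewrite ler_wpM2r ?dotvv_ge0//.
by apply: eigenvalue_le_beta => //; exists y.
Qed.

Lemma alpha_nincr (s t : R) : f xs <= s -> s <= t -> alpha f t <= alpha f s.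
Proof.
move=> xss st; apply: lb_le_inf; first exact: hessian_eigenvalues_nonempty.
move=> a [y ys ea]; apply: alpha_le_eigenvalue; first exact: le_trans st.
by exists y => //; exact: le_trans st.
Qed.

Lemma beta_ndecr (s t : R) : f xs <= s -> s <= t -> beta f s <= beta f t.
Proof.
move=> xss st; apply: ge_sup; first exact: hessian_eigenvalues_nonempty.
move=> a [y ys ea]; apply: eigenvalue_le_beta; first exact: le_trans st.
by exists y => //; exact: le_trans st.
Qed.

(** The Polyak-Lojasiewicz inequality: the strongly convex parabola below f at
    x, evaluated at the minimizer, is bounded below by its own minimum value,
    f x - |grad f x|^2 / (2 alpha). *)
Lemma gradient_dominates_gap (t : R) (x : 'rV[R]_n) : sublevel f t x ->
  f x - f xs <= dot (grad f x) (grad f x) / (2 * alpha f t).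
Proof.
move=> xt; have xst : f xs <= t := le_trans (xs_min.1 x) xt.
have a0 := alpha_gt0 t xst; set a := alpha f t in a0 *.
have /= := taylor_ge f fC2 x (xs - x) (a * dot (xs - x) (xs - x)).
rewrite [x + (xs - x)]addrC subrK => H.
have {}H : f x + dot (grad f x) (xs - x) + a * dot (xs - x) (xs - x) / 2
    <= f xs.
  apply: H => s s01; apply: alpha_quad => //; apply: sublevel_seg => //.
  by rewrite /sublevel /= addrC subrK.
set v := xs - x in H; set g := grad f x in H *.
have := dotvv_ge0 (g + a *: v).
rewrite dot_sqrD => K.
rewrite ler_pdivlMr ?mulr_gt0//.
have : a * (f x + dot g v + a * dot v v / 2) <= a * f xs by rewrite ler_pM2l.
lra.
Qed.

Lemma quadratic_growth (t : R) (x : 'rV[R]_n) : sublevel f t x ->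
  alpha f t / 2 * enorm (x - xs) ^+ 2 <= f x - f xs.
Proof.
move=> xt; have xst : f xs <= t := le_trans (xs_min.1 x) xt.
have /= := taylor_ge f fC2 xs (x - xs) (alpha f t * dot (x - xs) (x - xs)).
rewrite grad_dot_eq0; [|exact: fC2.1|by move=> s; exact: xs_min.1].
rewrite addr0 [xs + (x - xs)]addrC subrK enorm_sqr => H.
have {}H : f xs + alpha f t * dot (x - xs) (x - xs) / 2 <= f x.
  apply: H => s s01; apply: alpha_quad => //; apply: sublevel_seg => //.
  by rewrite /sublevel /= addrC subrK.
lra.
Qed.

(** A step of length 1 / beta, as in gradient descent. The upper bound beta of
    the Hessian is available only inside the sublevel set, so the point is to
    show that x + v / beta belongs to it. If f still decreases along v at the
    end of the step, the tangent inequality shows this; otherwise the slope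
    vanishes at some s <= 1 / beta, the segment up to s lies in the sublevel
    set, and the slope cannot rise from - |v|^2 to 0 there before
    s = 1 / beta. *)
Lemma descent (x v : 'rV[R]_n) : dot (grad f x) v = - dot v v ->
  f (x + (beta f (f x))^-1 *: v) <= f x - dot v v / (2 * beta f (f x)).
Proof.
move=> gv; have xst : f xs <= f x := xs_min.1 x.
have b0 := beta_gt0 _ xst; set be := beta f (f x) in b0 *.
have [->|v0] := eqVneq v 0.
  by rewrite scaler0 addr0 dot0r mul0r subr0.
have vv0 : 0 < dot v v by rewrite dotvv_gt0.
pose dphi (r : R) := dot (grad f (x + r *: v)) v.
have dphid (s : R) : is_derive s 1 dphi (quad (hessian f (x + s *: v)) v).
  exact: (is_derive_line (fun y => dot (grad f y) v) _ _ _ _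
    (is_derive_dot_grad f fC2 _ _ _)).
have below s : 0 <= s -> dphi s <= 0 -> sublevel f (f x) (x + s *: v).
  move=> s0 ds; have := tangent_le (x + s *: v) (- s *: v).
  rewrite dotZr -/(dphi s) scaleNr addrK /sublevel /= => /(le_trans _); apply.
  by rewrite lerDl mulNr oppr_ge0 mulr_ge0_le0.
have xb : sublevel f (f x) (x + be^-1 *: v).
  have [|db] := leP (dphi be^-1) 0; first by apply: below; rewrite invr_ge0 ltW.
  have d00 : dphi 0 = - dot v v by rewrite /dphi scale0r addr0.
  have [|||s sI ds] := @IVT R dphi 0 be^-1 0.
  - by rewrite invr_ge0 ltW.
  - exact/continuous_subspaceT/(is_derive_cont _ _ dphid).
  - by rewrite d00 ge_min le_max oppr_le0 (ltW vv0) (ltW db) orbT.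
  move: sI; rewrite in_itv/= => /andP[s0 sb].
  have xs' : sublevel f (f x) (x + s *: v) by apply: below; rewrite // ds.
  have [th th01 E] := MVT_from0 dphi _ s dphid.
  suff -> : be^-1 = s by [].
  apply/eqP; rewrite eq_le sb andbT -[leLHS]mul1r ler_pdivrMr//.
  have Q : quad (hessian f (x + (th * s) *: v)) v <= be * dot v v.
    apply: quad_beta => //; rewrite -scalerA; apply: sublevel_seg => //.
    exact: lexx.
  move: E; rewrite ds d00 sub0r opprK => E.
  have : dot v v <= be * dot v v * s by rewrite {1}E ler_wpM2r.
  rewrite -mulrA [dot v v * s]mulrC mulrA -[leLHS]mul1r ler_pM2r//.
  by rewrite [be * s]mulrC.
have /= := taylor_le f fC2 x (be^-1 *: v) (be * dot (be^-1 *: v) (be^-1 *: v)).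
move=> H; apply: le_trans (H _) _ => [s s01|].
  apply: quad_beta => //; apply: sublevel_seg => //; exact: lexx.
rewrite !dotZr gv [dot (_ *: _) v]dotC dotZr.
rewrite -addrA.
suff -> : be^-1 * - dot v v + be * (be^-1 * (be^-1 * dot v v)) / 2 =
    - (dot v v / (2 * be)).
  exact: lexx.
by field; rewrite gt_eqF.
Qed.

Lemma hessian_quad_near (eps : R) : 0 < eps ->
  exists2 del, 0 < del & forall y, enorm (y - xs) < del -> forall v,
    `|quad (hessian f y) v - quad (hessian f xs) v| <= eps * dot v v.
Proof.
move=> eps0.
pose phi (y : 'rV[R]_n) : R :=
    \sum_j \sum_i `|hessian f y i j - hessian f xs i j|.
have phic : continuous phi.
  apply: (continuous_big add_continuous) => j _.
  apply: (continuous_big add_continuous) => i _ y.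
  apply: (@continuous_comp _ _ _
    (fun y => hessian f y i j - hessian f xs i j) Num.norm).
    by apply: continuousB; [exact: hessian_continuous|exact: cst_continuous].
  exact: norm_continuous.
have phi0 : phi xs = 0.
  by rewrite /phi big1// => j _; rewrite big1// => i _; rewrite subrr normr0.
have /cvgrPdist_lt /(_ _ eps0) /nbhs_normP[r /= r0 Hr] := phic xs.
exists r => // y yr v.
apply: le_trans (quad_dist_le _ _ _) _; rewrite -/(phi y).
rewrite ler_wpM2r ?dotvv_ge0//.
have := Hr y; rewrite phi0 sub0r normrN => H.
apply: le_trans (ler_norm _) (ltW (H _)).
by rewrite /ball_ /= distrC; apply: le_lt_trans yr; exact: norm_le_enorm.
Qed.

(** By quadratic growth, sublevel sets shrink to the minimizer as the level
    decreases to the minimum, and the Hessian is continuous there. The modulus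
    of growth is taken at the fixed level f xs + 1, so that it does not depend
    on t. *)
Lemma alpha_beta_near (eps : R) : 0 < eps ->
  exists2 tau, 0 < tau & forall t, f xs <= t -> t - f xs < tau ->
    alpha f (f xs) - eps <= alpha f t /\ beta f t <= beta f (f xs) + eps.
Proof.
move=> eps0; have [del del0 Hdel] := hessian_quad_near eps eps0.
have T0 : f xs <= f xs + 1 by rewrite lerDl.
have a0 := alpha_gt0 _ T0.
exists (Num.min 1 (alpha f (f xs + 1) / 2 * del ^+ 2)).
  by rewrite lt_min ltr01 mulr_gt0 ?exprn_gt0// divr_gt0.
move=> t xst; rewrite lt_min => /andP[t1 td].
have near y : sublevel f t y -> enorm (y - xs) < del.
  move=> yt; rewrite -(@ltr_pXn2r _ 2)// ?nnegrE ?enorm_ge0 ?ltW//.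
  have : sublevel f (f xs + 1) y.
    by apply: le_trans yt _; rewrite -lerBlDl ltW.
  move=> /(quadratic_growth _ _) H.
  have yt' : f y - f xs <= t - f xs by rewrite lerD2r.
  have := le_lt_trans H (le_lt_trans yt' td).
  by rewrite ltr_pM2l// divr_gt0.
have lower (p q r e : R) : `|p - q| <= e -> r <= q -> r - e <= p.
  by rewrite ler_norml => /andP[]; lra.
have upper (p q r e : R) : `|p - q| <= e -> q <= r -> p <= r + e.
  by rewrite ler_norml => /andP[]; lra.
split.
- apply: lb_le_inf; first exact: hessian_eigenvalues_nonempty.
  move=> a [y /near/Hdel Q /eigenvalue_quad[v v0 E]].
  rewrite -(@ler_pM2r _ (dot v v)) ?dotvv_gt0// -E mulrBl.
  apply: (lower _ _ _ _ (Q v)).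
  exact: (alpha_quad (f xs) xs v (lexx _) (lexx _)).
- apply: ge_sup; first exact: hessian_eigenvalues_nonempty.
  move=> a [y /near/Hdel Q /eigenvalue_quad[v v0 E]].
  rewrite -(@ler_pM2r _ (dot v v)) ?dotvv_gt0// -E mulrDl.
  apply: (upper _ _ _ _ (Q v)).
  exact: (quad_beta (f xs) xs v (lexx _) (lexx _)).
Qed.

Lemma alpha_cvg (t : nat -> R) : (forall k, f xs <= t k) ->
  t k @[k --> \oo] --> f xs -> alpha f (t k) @[k --> \oo] --> alpha f (f xs).
Proof.
move=> xst tc; apply/cvgrPdist_le => eps eps0.
have [tau tau0 H] := alpha_beta_near eps eps0.
have /cvgrPdist_lt /(_ _ tau0) := tc; apply: filterS => k.
rewrite distrC ger0_norm ?subr_ge0// => /(H _ (xst k))[H1 _].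
rewrite ger0_norm ?subr_ge0; first by rewrite lerBlDr -lerBlDl.
by apply: alpha_nincr.
Qed.

Lemma beta_cvg (t : nat -> R) : (forall k, f xs <= t k) ->
  t k @[k --> \oo] --> f xs -> beta f (t k) @[k --> \oo] --> beta f (f xs).
Proof.
move=> xst tc; apply/cvgrPdist_le => eps eps0.
have [tau tau0 H] := alpha_beta_near eps eps0.
have /cvgrPdist_lt /(_ _ tau0) := tc; apply: filterS => k.
rewrite distrC ger0_norm ?subr_ge0// => /(H _ (xst k))[_ H1].
rewrite distrC ger0_norm ?subr_ge0; first by rewrite lerBlDl.
by apply: beta_ndecr.
Qed.

End convex_calculus.

(** * Blocks of variables and one step of partial minimization *)

Section blocks.
Context {R : realType} {d : nat} {m : 'I_d -> nat}.
Implicit Types (x u : 'rV[R]_(\sum_i m i)).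

Lemma submxrow_set_block x j (y : 'rV[R]_(m j)) i :
  submxrow (set_block x j y) i =
  eqtype.dfwith (fun l => submxrow x l) y i.
Proof. by rewrite /set_block mxrowK. Qed.

Lemma dot_blocks u x :
  dot u x = \sum_l dot (submxrow u l) (submxrow x l).
Proof.
rewrite /dot -[u in LHS]submxrowK -[x in LHS]submxrowK tr_mxrow.
by rewrite mul_mxrow_mxcol summxE.
Qed.

Lemma dot_set_block0 u j (w : 'rV[R]_(m j)) :
  dot u (set_block 0 j w) = dot (submxrow u j) w.
Proof.
rewrite dot_blocks (bigD1 j)//= submxrow_set_block dfwith_in big1 ?addr0//
  => i ij.
by rewrite submxrow_set_block dfwith_out 1?eq_sym// submxrow0 dot0r.
Qed.

Lemma set_block_add x j (y w : 'rV[R]_(m j)) (s : R) :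
  set_block x j y + s *: set_block 0 j w = set_block x j (y + s *: w).
Proof.
apply/mxrowP => i; rewrite submxrowD.
have -> : submxrow (s *: set_block 0 j w) i = s *: submxrow (set_block 0 j w) i.
  by apply/matrixP => a b; rewrite !mxE.
rewrite !submxrow_set_block; have [<-|ij] := eqVneq j i.
  by rewrite !dfwith_in.
by rewrite !dfwith_out// submxrow0 scaler0 addr0.
Qed.

Lemma set_block_id x j : set_block x j (submxrow x j) = x.
Proof.
apply/mxrowP => i; rewrite submxrow_set_block.
by have [<-|ij] := eqVneq j i; rewrite ?dfwith_in ?dfwith_out.
Qed.

Lemma max_block_ge (g : 'rV[R]_(\sum_i m i)) j :
  (forall l, enorm (submxrow g l) <= enorm (submxrow g j)) ->
  dot g g <= d%:R * dot (submxrow g j) (submxrow g j).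
Proof.
move=> H; rewrite dot_blocks.
apply: (@le_trans _ _ (\sum_(l < d) dot (submxrow g j) (submxrow g j))).
  apply: ler_sum => l _; rewrite -!enorm_sqr ler_pXn2r// nnegrE enorm_ge0//.
by rewrite sumr_const card_ord mulr_natl.
Qed.

(** When one block vanishes, only d - 1 of the summands contribute: this is the
    source of the better rate of all steps but the first one. *)
Lemma max_block_ge_null (g : 'rV[R]_(\sum_i m i)) j l0 :
  submxrow g l0 = 0 ->
  (forall l, enorm (submxrow g l) <= enorm (submxrow g j)) ->
  dot g g <= (d%:R - 1) * dot (submxrow g j) (submxrow g j).
Proof.
move=> g0 H; rewrite dot_blocks (bigD1 l0)//= g0 dot0r add0r.
apply: (@le_trans _ _
    (\sum_(l < d | l != l0) dot (submxrow g j) (submxrow g j))).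
  by apply: ler_sum => l _; rewrite -!enorm_sqr ler_pXn2r// nnegrE enorm_ge0.
rewrite mulrBl mul1r mulr_natl.
have := sumr_const 'I_d (dot (submxrow g j) (submxrow g j)).
rewrite (bigD1 l0)//= card_ord => <-.
by rewrite addrAC subrr add0r.
Qed.

Context (f : 'rV[R]_(\sum_i m i) -> R).
Context (fC2 : C2 f) (fconv : forall x, pos_def (hessian f x)).
Context (n0 : (0 < \sum_i m i)%N).
Context (xs : 'rV[R]_(\sum_i m i)) (xs_min : unique (minimizer f) xs).

Lemma step_nincr x x' : partial_minimization_step f x x' -> f x' <= f x.
Proof.
move=> [j [_ [y [[ymin _] ->]]]].
by have := ymin (submxrow x j); rewrite set_block_id.
Qed.

(** First-order optimality of the block that has just been minimized over. *)
Lemma step_block_grad_eq0 x x' : partial_minimization_step f x x' ->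
  exists l, block_grad f x' l = 0.
Proof.
move=> [j [_ [y [[ymin _] ->]]]]; exists j; rewrite /block_grad.
apply/eqP; rewrite -dotvv_eq0 -dot_set_block0; apply/eqP.
apply: grad_dot_eq0; first exact: fC2.1.
by move=> s; rewrite set_block_add; exact: ymin.
Qed.

(** The exact block minimizer does at least as well as the gradient step along
    the same block. *)
Lemma step_descent x x' : partial_minimization_step f x x' ->
  exists j, (forall l, enorm (block_grad f x l) <= enorm (block_grad f x j)) /\
    f x' <= f x -
      dot (block_grad f x j) (block_grad f x j) / (2 * beta f (f x)).
Proof.
move=> [j [jmax [y [[ymin _] ->]]]]; exists j; split => //.
set g := block_grad f x j.
have vv : dot (set_block 0 j (- g)) (set_block 0 j (- g)) = dot g g.
  rewrite dot_set_block0 submxrow_set_block dfwith_in dotNr dotC dotNr.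
  exact: opprK.
have := descent f fC2 fconv n0 xs xs_min x (set_block 0 j (- g)).
rewrite vv dot_set_block0 dotNr => /(_ (erefl _)) /(le_trans _); apply.
by rewrite -{2}(set_block_id x j) set_block_add; exact: ymin.
Qed.

(** The decrease |g_j|^2 / (2 beta) is compared with the gap, which is at most
    |grad f|^2 / (2 alpha) <= D |g_j|^2 / (2 alpha). *)
Lemma step_contraction x x' (D : R) :
  partial_minimization_step f x x' -> 0 < D ->
  (forall j, (forall l, enorm (block_grad f x l) <= enorm (block_grad f x j)) ->
    dot (grad f x) (grad f x) <=
      D * dot (block_grad f x j) (block_grad f x j)) ->
  f x' - f xs <= (f x - f xs) * (1 - 1 / (D * kappa f (f x))).
Proof.
move=> st D0 HD; have xst : f xs <= f x := xs_min.1 x.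
have a0 := alpha_gt0 f fC2 fconv n0 xs xs_min _ xst.
have b0 := beta_gt0 f fC2 fconv n0 xs xs_min _ xst.
have [j [/HD gD desc]] := step_descent x x' st.
have pl := gradient_dominates_gap f fC2 fconv n0 xs xs_min (f x) x (lexx _).
rewrite /kappa; move: gD desc pl a0 b0.
move: (dot (grad f x) _) (dot (block_grad f x j) _).
move: (alpha f (f x)) (beta f (f x)).
move=> a b gg gj gD desc pl a0 b0.
have {}pl : f x - f xs <= D * gj / (2 * a).
  by apply: le_trans pl _; rewrite ler_wpM2r// invr_ge0 mulr_ge0// ltW.
have H : (f x - f xs) * (a / (D * b)) <= gj / (2 * b).
  have -> : gj / (2 * b) = D * gj / (2 * a) * (a / (D * b)).
    by field; rewrite !gt_eqF.
  by rewrite ler_wpM2r// divr_ge0 ?mulr_ge0// ltW.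
have -> : 1 / (D * (b / a)) = a / (D * b) by field; rewrite !gt_eqF.
lra.
Qed.

Lemma step_contraction_first x x' : partial_minimization_step f x x' ->
  (0 < d)%N ->
  f x' - f xs <= (f x - f xs) * (1 - 1 / (d%:R * kappa f (f x))).
Proof.
move=> st d0; apply: step_contraction => //; first by rewrite ltr0n.
by move=> j; exact: max_block_ge.
Qed.

Lemma step_contraction_next x x' l0 : partial_minimization_step f x x' ->
  (1 < d)%N -> block_grad f x l0 = 0 ->
  f x' - f xs <= (f x - f xs) * (1 - 1 / ((d%:R - 1) * kappa f (f x))).
Proof.
move=> st d1 gl0; apply: step_contraction => //.
  by rewrite subr_gt0 ltr1n.
by move=> j; exact: max_block_ge_null gl0.
Qed.

End blocks.

(** * Iterated partial minimization *)

Section partial_minimization_sequence.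
Context {R : realType} {d : nat} {m : 'I_d -> nat}.
Context (hd : (2 <= d)%N) (n0 : (0 < \sum_i m i)%N).
Context (f : 'rV[R]_(\sum_i m i) -> R).
Context (fC2 : C2 f) (fconv : forall x, pos_def (hessian f x)).
Context (xs : 'rV[R]_(\sum_i m i)) (xs_min : unique (minimizer f) xs).
Context (x : nat -> 'rV[R]_(\sum_i m i)).
Context (hx : forall k, partial_minimization_step f (x k) (x k.+1)).

Let t k := f (x k).
Let kap k := kappa f (t k).
Let first_rate (k : nat) : R := 1 - 1 / (d%:R * kap k).
Let next_rate (k : nat) : R := 1 - 1 / ((d%:R - 1) * kap k).

Let xst k : f xs <= t k. Proof. exact: xs_min.1. Qed.
Let a0 k : 0 < alpha f (t k).
Proof. exact: (alpha_gt0 f fC2 fconv n0 xs xs_min). Qed.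
Let b0 k : 0 < beta f (t k).
Proof. exact: (beta_gt0 f fC2 fconv n0 xs xs_min). Qed.

Lemma values_nincr : nonincreasing_seq t.
Proof. by apply/nonincreasing_seqP => k; exact: step_nincr. Qed.

Lemma alpha_values_ndecr i j : (i <= j)%N -> alpha f (t i) <= alpha f (t j).
Proof.
by move=> ij; apply: (alpha_nincr f fC2 fconv n0 xs xs_min);
  rewrite ?values_nincr.
Qed.

Lemma beta_values_nincr i j : (i <= j)%N -> beta f (t j) <= beta f (t i).
Proof.
by move=> ij; apply: (beta_ndecr f fC2 fconv n0 xs xs_min);
  rewrite ?values_nincr.
Qed.

Lemma kappa_ge1 k : 1 <= kap k.
Proof.
by rewrite ler_pdivlMr// mul1r; exact: (alpha_le_beta f fC2 fconv n0 xs xs_min).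
Qed.

Lemma kappa_values_nincr i j : (i <= j)%N -> kap j <= kap i.
Proof.
move=> ij; apply: ler_pM.
- exact/ltW/b0.
- by rewrite invr_ge0; exact/ltW/a0.
- exact: beta_values_nincr.
rewrite lef_pV2 ?posrE; [exact: alpha_values_ndecr|exact: a0|exact: a0].
Qed.

Lemma rate_bounds (D : R) i j : 1 <= D -> (i <= j)%N ->
  [/\ 0 <= 1 - 1 / (D * kap j), 1 - 1 / (D * kap i) < 1 &
    1 - 1 / (D * kap j) <= 1 - 1 / (D * kap i)].
Proof.
move=> D1 ij; have D0 : 0 < D := lt_le_trans ltr01 D1.
have k0 k : 0 < kap k := lt_le_trans ltr01 (kappa_ge1 k).
have Dk k : 0 < D * kap k by rewrite mulr_gt0.
split.
- rewrite subr_ge0 ler_pdivrMr// mul1r -[leLHS]mul1r.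
  by rewrite ler_pM// kappa_ge1.
- by rewrite ltrBlDr ltrDl divr_gt0.
- rewrite lerD2l lerN2 ler_pM2l// lef_pV2 ?posrE// ler_pM2l//.
  exact: kappa_values_nincr.
Qed.

Let d1 : 1 <= (d%:R : R). Proof. by rewrite ler1n (leq_trans _ hd). Qed.
Let d2 : 1 <= (d%:R - 1 : R).
Proof. by rewrite lerBrDr -[_ + _]/(2%:R) ler_nat. Qed.

Let gap_step k : t k.+1 - f xs <= (t k - f xs) * first_rate k.
Proof.
by apply: (step_contraction_first f fC2 fconv n0 xs xs_min);
  rewrite // (leq_trans _ hd).
Qed.

Let gap_step_next k : t k.+2 - f xs <= (t k.+1 - f xs) * next_rate k.+1.
Proof.
have [l gl] := step_block_grad_eq0 f fC2 (x k) (x k.+1) (hx k).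
exact: (step_contraction_next f fC2 fconv n0 xs xs_min _ _ l).
Qed.

Lemma value_decreases k : x k <> xs -> t k.+1 < t k.
Proof.
move=> xk; have gap0 : 0 < t k - f xs.
  rewrite subr_gt0 lt_neqAle xst andbT; apply/eqP => E; apply: xk; apply/esym.
  by apply: xs_min.2 => z; rewrite -/(t k) -E; exact: xs_min.1.
rewrite -(ltrD2r (- f xs)); apply: le_lt_trans (gap_step k) _.
have [_ r1 _] := rate_bounds _ k k d1 (leqnn k).
by rewrite -[ltRHS]mulr1 ltr_pM2l.
Qed.

(** The first-step rate at index 0 bounds those at later indices, so the gap is
    dominated by a geometric sequence. *)
Lemma values_cvg : t k @[k --> \oo] --> f xs.
Proof.
have [q0 q1 _] := rate_bounds _ 0 0 d1 (leqnn 0).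
have geom k : t k - f xs <= (t 0%N - f xs) * first_rate 0 ^+ k.
  elim: k => [|k IH]; first by rewrite expr0 mulr1.
  apply: le_trans (gap_step k) _; rewrite exprSr mulrA.
  have [r0 _ r01] := rate_bounds _ 0 k d1 (leq0n k).
  by apply: ler_pM => //; rewrite subr_ge0.
have bound : (t 0%N - f xs) * first_rate 0 ^+ k + f xs @[k --> \oo] --> f xs.
  rewrite -[X in _ --> X]add0r -[X in _ --> X + _](mulr0 (t 0%N - f xs)).
  apply: cvgD; last exact: cvg_cst.
  by apply: cvgM; [exact: cvg_cst|apply: cvg_expr; rewrite ger0_norm].
apply: (squeeze_cvgr _ (cvg_cst (f xs)) bound).
by apply: nearW => k; rewrite xst/= -lerBlDr geom.
Qed.

Lemma product_rate_ge0 k :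
  0 <= first_rate 0 * \prod_(1 <= i < k) next_rate i.
Proof.
have [q0 _ _] := rate_bounds _ 0 0 d1 (leqnn 0).
rewrite mulr_ge0// prodr_ge0// => i _.
by have [r0 _ _] := rate_bounds _ i i d2 (leqnn i).
Qed.

(** After the first step, the current point always has a block of zero gradient,
    namely the block minimized over last; hence d - 1 in the factors of index
    at least 1. *)
Lemma gap_le_product k : (1 <= k)%N ->
  t k - f xs <=
  (t 0%N - f xs) * (first_rate 0 * \prod_(1 <= i < k) next_rate i).
Proof.
case: k => // k _; elim: k => [|k IH]; first by rewrite big_geq// mulr1.
rewrite big_nat_recr//= [X in _ * X]mulrA mulrA.
apply: le_trans (gap_step_next k) _; apply: ler_wpM2r IH.
by have [r0 _ _] := rate_bounds _ k.+1 k.+1 d2 (leqnn _).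
Qed.

Lemma product_le_power k :
  \prod_(1 <= i < k) next_rate i <= next_rate 0 ^+ (k - 1).
Proof.
rewrite -prodr_const_nat; apply: ler_prod => i _.
by have [r0 _ r1] := rate_bounds _ 0 i d2 (leq0n i); rewrite r0.
Qed.

End partial_minimization_sequence.

Theorem theorem2p4 (R : realType) (d : nat) (m : 'I_d -> nat)
    (hd : (2 <= d)%N) (hm : forall i, (1 <= m i)%N)
    (f : 'rV[R]_(\sum_i m i) -> R)
    (hC2 : C2 f) (hconv : forall x, pos_def (hessian f x))
    (xstar : 'rV[R]_(\sum_i m i)) (hmin : unique (minimizer f) xstar)
    (x : nat -> 'rV[R]_(\sum_i m i))
    (hx : forall k, partial_minimization_step f (x k) (x k.+1)) :
  let t := fun k => f (x k) in
  let tstar := f xstar in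
  (forall k, 0 < alpha f (t k) /\ alpha f (t k) <= beta f (t k)) /\
  (* (1) *)
  (forall k, (1 <= k)%N -> x k.-1 <> xstar -> t k < t k.-1) /\
  (* (2) *)
  ((nonincreasing_seq t /\ t k @[k --> \oo] --> tstar) /\
   (nonincreasing_seq (fun k => beta f (t k)) /\
    beta f (t k) @[k --> \oo] --> beta f tstar) /\
   (nonincreasing_seq (fun k => - alpha f (t k)) /\
    - alpha f (t k) @[k --> \oo] --> - alpha f tstar) /\
   (nonincreasing_seq (fun k => kappa f (t k)) /\
    kappa f (t k) @[k --> \oo] --> kappa f tstar)) /\
  (* (3) *)
  (forall k, (1 <= k)%N ->
   let P := (1 - 1 / (d%:R * kappa f (t 0%N))) *
     \prod_(1 <= i < k) (1 - 1 / ((d%:R - 1) * kappa f (t i))) in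
   let C := enorm (grad f (x 0%N)) ^+ 2 / (2 * alpha f (t 0%N)) in
   f (x k) - f xstar <= (f (x 0%N) - f xstar) * P /\
   (f (x 0%N) - f xstar) * P <= C * P /\
   C * P <= C * (1 - 1 / (d%:R * kappa f (t 0%N))) *
     (1 - 1 / ((d%:R - 1) * kappa f (t 0%N))) ^+ (k - 1) /\
   enorm (x k - xstar) ^+ 2 <=
     enorm (grad f (x 0%N)) ^+ 2 / (alpha f (t k) * alpha f (t 0%N)) * P).
Proof.
move=> t ts.
have n0 : (0 < \sum_i m i)%N.
  have d0 : (0 < d)%N by apply: leq_trans hd.
  by rewrite (bigD1 (Ordinal d0))//= ltn_addr// hm.
have xst k : f xstar <= t k := hmin.1 (x k).
have a0 k : 0 < alpha f (t k) by exact: (alpha_gt0 f hC2 hconv n0 xstar hmin).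
have as0 : 0 < alpha f ts by exact: (alpha_gt0 f hC2 hconv n0 xstar hmin).
have tc : t k @[k --> \oo] --> ts.
  exact: (values_cvg hd n0 f hC2 hconv xstar hmin x hx).
have ac := alpha_cvg f hC2 hconv n0 xstar hmin t xst tc.
have bc := beta_cvg f hC2 hconv n0 xstar hmin t xst tc.
split; [|split; [|split]].
- by move=> k; split => //; exact: (alpha_le_beta f hC2 hconv n0 xstar hmin).
- by case=> // k _; exact: (value_decreases hd n0 f hC2 hconv xstar hmin x hx).
- split; [|split; [|split]].
  + by split => //; exact: (values_nincr f x hx).
  + split=> // i j ij.
    exact: (beta_values_nincr n0 f hC2 hconv xstar hmin x hx).
  + split; last exact: cvgN.
    by move=> i j ij; rewrite lerN2;
    exact: (alpha_values_ndecr n0 f hC2 hconv xstar hmin x hx).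
  + split; last by apply: cvgM => //; apply: cvgV => //; rewrite gt_eqF.
    move=> i j ij; exact: (kappa_values_nincr n0 f hC2 hconv xstar hmin x hx).
move=> k k1 P C.
have P0 : 0 <= P := product_rate_ge0 hd n0 f hC2 hconv xstar hmin x hx k.
have gapP : f (x k) - f xstar <= (f (x 0%N) - f xstar) * P :=
  gap_le_product hd n0 f hC2 hconv xstar hmin x hx k k1.
have gapC : f (x 0%N) - f xstar <= C.
  rewrite /C enorm_sqr.
  apply: (gradient_dominates_gap f hC2 hconv n0 xstar hmin).
  exact: lexx.
have C0 : 0 <= C by apply: le_trans gapC; rewrite subr_ge0;
  exact: (xst 0%N).
have gapCP : (f (x 0%N) - f xstar) * P <= C * P by rewrite ler_wpM2r.
split => //; split => //; split.
  rewrite -mulrA ler_wpM2l// ler_wpM2l//.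
    have := product_rate_ge0 hd n0 f hC2 hconv xstar hmin x hx 0.
    by rewrite big_geq// mulr1.
  exact: (product_le_power hd n0 f hC2 hconv xstar hmin x hx k).
have := quadratic_growth f hC2 hconv n0 xstar hmin (t k) (x k) (lexx _).
move=> /le_trans /(_ gapP) /le_trans /(_ gapCP).
rewrite /C; move: (enorm _) (enorm _) (alpha f (t k)) (a0 k) => g e a a_gt0.
have A0 := a0 0%N; rewrite -/(t 0%N); move: (alpha f (t 0%N)) A0 => b b_gt0 H.
have -> : g ^+ 2 / (a * b) * P = (a / 2)^-1 * (g ^+ 2 / (2 * b) * P).
  by field; rewrite !gt_eqF.
by rewrite ler_pdivlMl// divr_gt0.
Qed.
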